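(* If a real $X$ is $1$-generic relative to some perfect tree, then $X$ is not ranked.
   Context: A real is an element of $2^\omega$. A perfect tree is a nonempty set $T \subseteq 2^{<\omega}$ closed under initial segments such that every $\sigma \in T$ has two incompatible extensions in $T$. A real $X$ is a path through $T$ if $X|k \in T$ for all $k$, where $X|k$ is the initial segment of $X$ of length $k$. A real $X$ is $1$-generic relative to a perfect tree $T$ if $X$ is a path through $T$ and for every $\Sigma^0_1(T)$ set $S$ of finite binary strings there is a $k$ such that either $X|k \in S$ or $\sigma \notin S$ for every $\sigma \in T$ extending $X|k$; $X$ is $1$-generic relative to some perfect tree if such a $T$ exists. A real is ranked if it is a member of a countable $\Pi^0_1$ subset of $2^\omega$; equivalently, if it is a path through a recursive tree (in $2^{<\omega}$) with no perfect subtrees. *)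

(* Defs.v *)
From mathcomp Require Import all_boot.
From mathcomp Require Import boolp classical_sets cardinality.

Set Implicit Arguments.
Unset Strict Implicit.
Unset Printing Implicit Defensive.

Local Open Scope classical_set_scope.

(* Indices of n-ary mu-recursive functions with a set oracle. *)
Inductive recf : nat -> Type :=
| RZero n : recf n
| RSucc : recf 1
| RProj n (i : 'I_n) : recf n
| ROracle : recf 1
| RComp m n (f : recf m) (gs : 'I_m -> recf n) : recf n
| RPrec n (f : recf n) (g : recf n.+2) : recf n.+1
| RMu n (f : recf n.+1) : recf n.

(* The graph of h(0, u) = f(u), h(x+1, u) = g(x, h(x, u), u) in terms of the
   graphs [F] and [G] of the partial functions f and g. *)
Fixpoint prim_rec n (F : n.-tuple nat -> nat -> Prop)
    (G : n.+2.-tuple nat -> nat -> Prop) (u : n.-tuple nat) (x y : nat) : Prop :=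
  if x is x'.+1 then
    exists2 t, prim_rec F G u x' t & G [tuple of x' :: t :: u] y
  else F u y.

(* [eval A f v y]: the partial function with index [f], computed with the
   characteristic function of [A] as oracle, is defined at [v] with value [y].
   [RMu f] is the least y with f(y, v) = 0, f being defined below y. *)
Fixpoint eval (A : set nat) n (f : recf n) : n.-tuple nat -> nat -> Prop :=
  match f in recf n return n.-tuple nat -> nat -> Prop with
  | RZero _ => fun _ y => y = 0
  | RSucc => fun v y => y = (thead v).+1
  | RProj _ i => fun v y => y = tnth v i
  | ROracle => fun v y => y = nat_of_bool `[< A (thead v) >]
  | RComp m _ f gs => fun v y =>
      exists2 w : m.-tuple nat,
        forall i, eval A (gs i) v (tnth w i) & eval A f w y
  | RPrec _ f g => fun v y =>
      prim_rec (eval A f) (eval A g) (behead_tuple v) (thead v) y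
  | RMu _ f => fun v y =>
      eval A f [tuple of y :: v] 0 /\
      forall z, z < y -> exists t, eval A f [tuple of z :: v] t.+1
  end.

(* [recursive_in set0] is plain recursiveness. *)
Definition recursive_in (A : set nat) n (R : set (n.-tuple nat)) : Prop :=
  exists f : recf n, forall v, eval A f v (nat_of_bool `[< R v >]).

(* A recursive bijection between binary strings and natural numbers
   (bijective base 2, least significant digit first). *)
Fixpoint code (s : seq bool) : nat :=
  if s is b :: s' then (b + (code s').*2).+1 else 0.

Lemma code_bij : bijective code.
Proof.
have inj : injective code.
  elim=> [|b s IH] [|c t] //= [eq_bc].
  have eb : b = c.
    by move/(congr1 odd): eq_bc; rewrite !oddD !odd_double !addbF; case: b c => [] [].
  by rewrite eb in eq_bc *; move/addnI/double_inj/IH: eq_bc => ->.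
have surj n : exists s, code s = n.
  have [m] := ubnP n; elim: m n => // m IH [|n] lt_nm; first by exists [::].
  have [s es] : exists s, code s = n./2.
    apply: IH; apply: leq_ltn_trans (lt_nm : n < m).
    by rewrite -[leqRHS]odd_double_half -addnn addnA leq_addl.
  by exists (odd n :: s); rewrite /= es odd_double_half.
have [g gK] := choice surj.
by exists g => // s; apply: inj.
Qed.

Definition real := nat -> bool.

Definition restr (X : real) (k : nat) : seq bool := mkseq X k.

(* [S] and [T] are identified with sets of natural numbers through [code]. *)
Definition sigma01_in (T S : set (seq bool)) : Prop :=
  exists2 R : set (2.-tuple nat), recursive_in (code @` T) R &
    forall s, S s <-> exists n, R [tuple code s; n].

Definition recursive_strings (R : set (seq bool)) : Prop :=
  recursive_in set0 [set v : 1.-tuple nat | (code @` R) (thead v)].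

(* [R] need not be a tree; when it is one, [P] is the set of its paths. *)
Definition pi01_class (P : set real) : Prop :=
  exists2 R : set (seq bool), recursive_strings R &
    forall X, P X <-> forall k, R (restr X k).

Definition compatible (s t : seq bool) : bool := prefix s t || prefix t s.

Definition perfect_tree (T : set (seq bool)) : Prop :=
  [/\ T !=set0,
      forall s t, prefix s t -> T t -> T s &
      forall s, T s -> exists t u,
        [/\ T t, T u, prefix s t, prefix s u & ~~ compatible t u]].

Definition path_through (T : set (seq bool)) (X : real) : Prop :=
  forall k, T (restr X k).

Definition one_generic_rel (T : set (seq bool)) (X : real) : Prop :=
  path_through T X /\
  forall S, sigma01_in T S -> exists k,
    S (restr X k) \/
    forall s, T s -> prefix (restr X k) s -> ~ S s.

Definition ranked (X : real) : Prop :=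
  exists P : set real, [/\ pi01_class P, countable P & P X].

(* Main.v *)
Require Import Defs.
From mathcomp Require Import all_boot.
From mathcomp Require Import boolp classical_sets cardinality.

(** Suppose that [X] lies in a countable class [P], the set of reals all of
    whose initial segments are in a recursive set [R].  The complement of [R]
    is recursive, a fortiori Sigma^0_1 relative to [T]
    ([sigma01_in_setC_recursive]), so genericity decides it along [X]: either
    some initial segment of [X] is outside [R], which [P X] excludes, or all
    the extensions in [T] of some [X|k] are in [R].  In the latter case every
    path through [T] extending [X|k] belongs to [P].  But above any of its nodes
    a perfect tree has uncountably many paths: one of them avoids [P], by
    Cantor's diagonal argument ([perfect_tree_path_notin]). *)

Set Implicit Arguments.
Unset Strict Implicit.
Unset Printing Implicit Defensive.

Local Open Scope classical_set_scope.

(** Only the value 0 is ever returned by the empty oracle, so oracle calls can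
    be replaced by the zero function; the resulting index no longer depends on
    the oracle. *)
Fixpoint empty_oracle n (f : recf n) : recf n :=
  match f in recf n return recf n with
  | RZero n => RZero n
  | RSucc => RSucc
  | RProj _ i => RProj i
  | ROracle => RZero 1
  | RComp _ _ f gs => RComp (empty_oracle f) (fun i => empty_oracle (gs i))
  | RPrec _ f g => RPrec (empty_oracle f) (empty_oracle g)
  | RMu _ f => RMu (empty_oracle f)
  end.

Lemma eval_empty_oracle A n (f : recf n) :
  eval A (empty_oracle f) = eval set0 f.
Proof.
elim: f => //= [|m {}n f IHf gs IHgs|{}n f IHf g IHg|{}n f IHf].
- by apply/funext => v; apply/funext => y; rewrite asboolF.
- apply/funext => v; apply/funext => y; rewrite IHf; apply/propext.
  by split=> -[w gsw fw]; exists w => // i; move: (gsw i); rewrite IHgs.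
- by rewrite IHf IHg.
- by rewrite IHf.
Qed.

Lemma recursive_in_set0 A n (R : set (n.-tuple nat)) :
  recursive_in set0 R -> recursive_in A R.
Proof.
by case=> f Rf; exists (empty_oracle f) => v; rewrite eval_empty_oracle.
Qed.

(** The function 1 - x (truncated), by primitive recursion on x. *)
Definition RSg_bar : recf 1 :=
  RPrec (RComp RSucc (fun _ => RZero 0)) (RZero 2).

Lemma eval_RSg_bar A (v : 1.-tuple nat) (b : bool) :
  thead v = b -> eval A RSg_bar v (~~ b).
Proof.
have one : eval A (RComp RSucc (fun _ => RZero 0)) (behead_tuple v) 1.
  by exists [tuple 0] => // i; rewrite (ord1 i).
by rewrite /= => ->; case: b => //=; exists 1.
Qed.

Lemma recursive_inC A n (R : set (n.-tuple nat)) :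
  recursive_in A R -> recursive_in A (~` R).
Proof.
case=> f Rf; exists (RComp RSg_bar (fun _ => f)) => v.
exists [tuple nat_of_bool `[< R v >]] => [i|].
  by rewrite (ord1 i); exact: Rf.
by rewrite asbool_neg; exact: eval_RSg_bar.
Qed.

Lemma recursive_in_thead A n (R : set (1.-tuple nat)) :
  recursive_in A R ->
  recursive_in A [set v : n.+1.-tuple nat | R [tuple thead v]].
Proof.
case=> f Rf; exists (RComp f (fun _ => RProj ord0)) => v.
by exists [tuple thead v]; [move=> i; rewrite (ord1 i) | exact: Rf].
Qed.

(** The existential quantifier of the Sigma^0_1 form is over a dummy variable,
    the complement being itself decidable. *)
Lemma sigma01_in_setC_recursive (T R : set (seq bool)) :
  recursive_strings R -> sigma01_in T (~` R).
Proof.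
move=> Rrec; exists [set v | ~ (code @` R) (thead v)].
  exact: recursive_inC (recursive_in_thead 1 (recursive_in_set0 _ Rrec)).
have codeR s : (code @` R) (code s) <-> R s.
  split=> [[t Rt]|Rs]; last by exists s.
  by move/(bij_inj code_bij) => <-.
move=> s; split=> [nRs|[n] /= nRs /codeR //].
by exists 0 => /= /codeR.
Qed.

Lemma size_restr X k : size (restr X k) = k.
Proof. exact: size_mkseq. Qed.

Lemma take_restr X j k : j <= k -> take j (restr X k) = restr X j.
Proof.
by move=> le_jk; rewrite /restr /mkseq -map_take take_iota (minn_idPl le_jk).
Qed.

Lemma prefix_restr X j k : j <= k -> prefix (restr X j) (restr X k).
Proof. by move=> le_jk; rewrite -(take_restr X le_jk) prefix_take. Qed.

Lemma compatible_restr X j k : compatible (restr X j) (restr X k).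
Proof.
by rewrite /compatible; case/orP: (leq_total j k) => /(prefix_restr X) ->;
  rewrite ?orbT.
Qed.

(** A node that extends [s] without being longer is [s] itself, and [s] is
    compatible with all of its extensions. *)
Lemma prefix_incompatible_size s t u :
  prefix s t -> prefix s u -> ~~ compatible t u -> size s < size t.
Proof.
move=> st su; apply: contraR; rewrite -leqNgt => le_ts.
suff -> : t = s by rewrite /compatible su.
move: st; rewrite prefixE => /eqP <-; by rewrite take_oversize.
Qed.

(** One step of the diagonal argument: at most one member of [P] has the index
    [n], and it cannot pass through both of two incompatible nodes. *)
Lemma perfect_tree_avoid (T : set (seq bool)) (P : set real) (f : real -> nat)
    s n :
  perfect_tree T -> {in P &, injective f} -> T s ->
  exists t, [/\ T t, prefix s t, size s < size t &
    forall Y, P Y -> f Y = n -> restr Y (size t) <> t].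
Proof.
case=> _ _ Tsplit f_inj /Tsplit [t [u [Tt Tu st su ntu]]].
have nut : ~~ compatible u t by rewrite /compatible orbC.
have [[Y [PY fY Yt]]|avoid] :=
    pselect (exists Y, [/\ P Y, f Y = n & restr Y (size t) = t]).
- exists u; split=> // [|Z PZ fZ Zu].
    exact: prefix_incompatible_size nut.
  have eqZY : Z = Y by apply: f_inj; rewrite ?inE // fZ.
  by move: ntu; rewrite -Yt -Zu eqZY compatible_restr.
- exists t; split=> // [|Y PY fY Yt].
    exact: prefix_incompatible_size ntu.
  by apply: avoid; exists Y.
Qed.

Lemma prefix_chain_limit (c : nat -> seq bool) :
  (forall n, prefix (c n) (c n.+1)) -> (forall n, size (c n) < size (c n.+1)) ->
  exists Y : real, forall n, n <= size (c n) /\ restr Y (size (c n)) = c n.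
Proof.
move=> cS ltc.
have lec n : n <= size (c n) by elim: n => // n IH; exact: leq_ltn_trans (ltc n).
have cP m n : m <= n -> prefix (c m) (c n).
  move=> /subnK <-; elim: (n - m) => [|d IH]; first exact: prefix_refl.
  exact: prefix_trans IH (cS _).
have cnth m n i : m <= n -> i < size (c m) -> nth false (c n) i = nth false (c m) i.
  by move=> /cP /prefixP [r ->] lt_i; rewrite nth_cat lt_i.
(* [c i] may have length [i] only, so the [i]-th bit is read off [c i.+1]. *)
exists (fun i => nth false (c i.+1) i) => n; split=> //.
apply: (@eq_from_nth _ false); rewrite size_restr // => i lt_i.
rewrite nth_mkseq //; have [le_in|lt_ni] := leqP i.+1 n.
  by rewrite (cnth _ _ _ le_in) // (leq_trans _ (lec _)).
exact: cnth (ltnW lt_ni) lt_i.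
Qed.

(** An injection [f] of [P] into the natural numbers drives the diagonal
    argument: the node [c n.+1] of the path rules out the member of [P] of index
    [n], if any. *)
Lemma perfect_tree_path_notin (T : set (seq bool)) (P : set real) s :
  perfect_tree T -> countable P -> T s ->
  exists Y, [/\ path_through T Y, restr Y (size s) = s & ~ P Y].
Proof.
move=> Tperf /countable_injP [f f_inj] Ts.
pose good n t := [set u | [/\ T u, prefix t u, size t < size u &
  forall Y, P Y -> f Y = n -> restr Y (size u) <> u]].
pose c := fix c n := if n is m.+1 then xget s (good m (c m)) else s.
have stepP n t : T t -> good n t (xget s (good n t)).
  move=> /(perfect_tree_avoid n Tperf f_inj) [u tu].
  exact: (@xgetI _ s (good n t) u tu).
have Tc n : T (c n) by elim: n => //= n /(stepP n) [].
have [n|n|Y Yc] := @prefix_chain_limit c; try by case: (stepP n _ (Tc n)).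
exists Y; split=> [k||PY]; last 1 first.
- have [_ _ _ /(_ Y PY erefl)] := stepP (f Y) _ (Tc (f Y)).
  by apply; case: (Yc (f Y).+1).
- have [lek Yk] := Yc k; case: Tperf => _ Tclosed _.
  by apply: (Tclosed _ (c k)) => //; rewrite -Yk prefix_restr.
- by case: (Yc 0).
Qed.

Theorem proposition5p1 (X : real) :
  (exists T : set (seq bool), perfect_tree T /\ one_generic_rel T X) ->
  ~ ranked X.
Proof.
case=> T [Tperf [TX Xgen]] [P [[R Rrec PR] Pcount PX]].
have RX := (PR X).1 PX.
have [k [|Rext]] := Xgen _ (sigma01_in_setC_recursive T Rrec); first by apply.
have [Y [TY Yk []]] := perfect_tree_path_notin Tperf Pcount (TX k).
rewrite size_restr in Yk.
(* Above level [k] the path stays in [R] by genericity; below, it agrees with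
   [X], which matters because [R] need not be closed under prefixes. *)
apply/PR => j; have [le_jk|/ltnW le_kj] := leqP j k.
  by rewrite -(take_restr Y le_jk) Yk take_restr.
by apply: contrapT; apply: Rext => //; rewrite -Yk prefix_restr.
Qed.
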